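(* Let $X_N=\{\boldsymbol{x}_1,\dots,\boldsymbol{x}_N\}\subset\mathbb{S}^2$ be a set of sampling nodes and let $X_M=\{\boldsymbol{x}_1',\dots,\boldsymbol{x}_M'\}\subset X_N$ be a subset of interpolation nodes. Let $\{b_1,\dots,b_R\}$ be a basis of $\Pi_r(\mathbb{S}^2)$, $R=(r+1)^2$, and let $$V_{N,r}=[b_j(\boldsymbol{x}_i)]_{i=1,\dots,N;\ j=1,\dots,R}\in\mathbb{R}^{N\times R},\qquad V_{M,r}=[b_j(\boldsymbol{x}_i')]_{i=1,\dots,M;\ j=1,\dots,R}\in\mathbb{R}^{M\times R}$$ be the corresponding Vandermonde matrices. Assume that (i) $\operatorname{rank}(V_{N,r})=R$, (ii) $\operatorname{rank}(V_{M,r})=M$. Then the matrix $$\mathcal{K}=\begin{bmatrix} V_{N,r}^\top V_{N,r} & V_{M,r}^\top\\ V_{M,r} & \boldsymbol{0}\end{bmatrix}\in\mathbb{R}^{(R+M)\times(R+M)}$$ is nonsingular. Moreover, $\mathcal{K}$ has exactly $R$ positive eigenvalues and $M$ negative eigenvalues (counted with multiplicity).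
   Context: $\mathbb{S}^2$ is the unit sphere in $\mathbb{R}^3$. $\Pi_r(\mathbb{S}^2)$ is the space of spherical polynomials of degree at most $r$ (restrictions to $\mathbb{S}^2$ of real polynomials in three variables of total degree at most $r$); its dimension is $R=(r+1)^2$. Conventions of the paper: the nodes are pairwise distinct, $N=(n+1)^2$, $M=(m+1)^2$, with integers $0\le m<r<n$. *)

(* Defs.v *)
From mathcomp Require Import all_boot all_order all_algebra.
From mathcomp Require Import reals.
From mathcomp Require Import mpoly.

Set Implicit Arguments.
Unset Strict Implicit.
Unset Printing Implicit Defensive.

Import Order.TTheory GRing.Theory Num.Theory.
Local Open Scope ring_scope.

Definition sphere (R : realType) : Type :=
  {u : 'rV[R]_3 | \sum_(i < 3) u 0 i ^+ 2 == 1}.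

(* [msize p] is 1 + the total degree of [p] (and 0 for [p = 0]). *)
Definition spherical_poly (R : realType) (r : nat) (f : sphere R -> R) : Prop :=
  exists2 p : {mpoly R[3]}, (msize p <= r.+1)%N &
    forall u : sphere R, f u = p.@[fun i => val u 0 i].

(* Linear independence and spanning are those of functions on the sphere, not
   of polynomials in three variables: different polynomials may have the same
   restriction. *)
Definition spherical_basis (R : realType) (r k : nat)
    (b : 'I_k -> sphere R -> R) : Prop :=
  [/\ forall j, spherical_poly r (b j),
      forall c : 'I_k -> R,
        (forall u, \sum_j c j * b j u = 0) -> forall j, c j = 0
    & forall f, spherical_poly r f ->
        exists c : 'I_k -> R, forall u, f u = \sum_j c j * b j u].

Definition vandermonde_mx (R : realType) (l k : nat)
    (x : 'I_l -> sphere R) (b : 'I_k -> sphere R -> R) : 'M[R]_(l, k) :=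
  \matrix_(i < l, j < k) b j (x i).

Definition kkt_mx (R : realType) (N M k : nat)
    (V : 'M[R]_(N, k)) (W : 'M[R]_(M, k)) : 'M[R]_(k + M) :=
  block_mx (V^T *m V) W^T W 0.

(* [s] lists all the eigenvalues of [A] with their algebraic multiplicities;
   it is unique up to permutation, and its existence means that all complex
   eigenvalues of [A] are real. *)
Definition spectrum (R : realType) (d : nat) (A : 'M[R]_d) (s : seq R) : Prop :=
  char_poly A = \prod_(z <- s) ('X - z%:P).

(* Main.v *)
(* Write the symmetric matrix K over the complex numbers as U^* diag(d) U.  A
   subspace of dimension p on which the quadratic form of K is positive definite
   forces at least p positive entries in d, and likewise for negative ones.
   With G = V^T V positive definite, the form is positive definite on the first
   block and negative definite on {(- y W G^-1, y)}, of dimension M; as the two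
   dimensions add up to the size of K, both bounds are equalities and no
   eigenvalue is 0. *)

Require Import Defs.
From mathcomp Require Import all_boot all_order all_algebra.
From mathcomp Require Import reals complex.
From mathcomp Require Import mpoly.

Set Implicit Arguments.
Unset Strict Implicit.
Unset Printing Implicit Defensive.

Import Order.TTheory GRing.Theory Num.Theory.
Local Open Scope ring_scope.
Local Open Scope sesquilinear_scope.

Lemma char_poly_invmx_conj (F : fieldType) n (P A : 'M[F]_n) :
  P \in unitmx -> char_poly (invmx P *m A *m P) = char_poly A.
Proof.
move=> Pu; pose Q := map_mx polyC P; pose Q' := map_mx polyC (invmx P).
have QK : Q' *m Q = 1%:M by rewrite -map_mxM mulVmx // map_mx1.
have -> : char_poly (invmx P *m A *m P) = \det (Q' *m char_poly_mx A *m Q).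
  rewrite /char_poly /char_poly_mx !map_mxM mulmxBr mulmxBl.
  by rewrite -/Q -/Q' scalar_mxC -(mulmxA _ Q') QK mulmx1.
by rewrite !det_mulmx mulrAC -det_mulmx QK det1 mul1r.
Qed.

(** The list has as many entries as the degree of the characteristic polynomial, so the two counts
    exhaust it and 0 is not an eigenvalue; up to sign, the determinant is the value of that
    polynomial at 0. *)
Lemma spectrum_unitmx (R : realType) n (A : 'M[R]_n) (s : seq R) :
  spectrum A s ->
  (count (fun z => 0 < z)%R s + count (fun z => z < 0)%R s)%N = n ->
  A \in unitmx.
Proof.
move=> sA cs; have szs : size s = n.
  by apply: succn_inj; rewrite -(size_char_poly A) sA size_prod_XsubC.
have s_neq0 : all (predU (fun z : R => 0 < z) (fun z => z < 0)) s.
  rewrite all_count szs -[X in _ == X]cs -count_predUI [X in (_ + X)%N](_ : _ = 0%N).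
    by rewrite addn0.
  rewrite (@eq_count _ _ pred0) ?count_pred0 // => z /=.
  by apply/negP => /andP[z0 /(lt_trans z0)]; rewrite ltxx.
rewrite unitmxE unitfE; apply/eqP => detA0.
have : root (char_poly A) 0.
  by rewrite rootE horner_coef0 char_poly_det detA0 mulr0.
by rewrite sA root_prod_XsubC => /(allP s_neq0) /=; rewrite ltxx.
Qed.

Section Hermitian.
Variable C : numClosedFieldType.

(** Vectors are rows, so a subspace is parametrized as [u *m B], with [u] ranging over all rows. *)
Definition herm_form n (A : 'M[C]_n) (u : 'rV[C]_n) : C :=
  (u *m A *m u^t*) 0 0.

(** The value is the squared norm of [u *m V^t*], and [V^t*] has independent rows. *)
Lemma herm_form_gram m n (V : 'M[C]_(m, n)) (u : 'rV[C]_n) :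
  \rank V = n -> u != 0 -> 0 < herm_form (V^t* *m V) u.
Proof.
move=> rV u0.
have -> : herm_form (V^t* *m V) u = dotmx (u *m V^t*) (u *m V^t*).
  by rewrite /herm_form dotmxE trmx_mul map_mxM trmxCK !mulmxA.
rewrite dnorm_gt0 mulmx_free_eq0 //.
by rewrite /row_free mxrank_map mxrank_tr rV eqxx.
Qed.

Lemma herm_form_diag n (d : 'rV[C]_n) (w : 'rV[C]_n) :
  herm_form (diag_mx d) w = \sum_i d 0 i * `|w 0 i| ^+ 2.
Proof.
rewrite /herm_form mxE; apply: eq_bigr => i _.
by rewrite mul_mx_diag !mxE normCK mulrA (mulrC (d 0 i)).
Qed.

(* Otherwise some nonzero vector of the subspace has no component along the
   positive entries of [d], and the form is not positive there. *)
Lemma posdef_leq_card n p (U : 'M[C]_n) (d : 'rV[C]_n) (B : 'M[C]_(p, n)) :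
  d \is a realmx ->
  (forall u : 'rV[C]_p, u != 0 ->
     0 < herm_form (U^t* *m diag_mx d *m U) (u *m B)) ->
  (p <= #|[set i | (0 < d 0 i)%R]|)%N.
Proof.
move=> dR posB; set S := [set i | _].
pose f (k : 'I_#|S|) : 'I_n := enum_val k.
(* Keeping only the columns indexed by [S] leaves p rows and [#|S|] columns; if the rows are
   independent, the rank p is at most [#|S|]. *)
suff /eqP <- : row_free (colsub f (B *m U^t*)) by apply: rank_leq_col.
apply: inj_row_free => u; rewrite mulmx_colsub mulmxA => uB0.
apply/eqP/negPn/negP => /posB.
set w := u *m B *m U^t*.
have -> : herm_form (U^t* *m diag_mx d *m U) (u *m B) = herm_form (diag_mx d) w.
  by rewrite /herm_form /w [in RHS]trmx_mul map_mxM trmxCK !mulmxA.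
rewrite herm_form_diag; apply/negP; rewrite le_gtF //.
apply: sumr_le0 => i _; have [iS|] := boolP (i \in S).
  have /matrixP/(_ 0 (enum_rank_in iS i)) := uB0.
  by rewrite !mxE /f enum_rankK_in // => ->; rewrite normr0 expr0n mulr0.
rewrite inE -real_leNgt // => [d0|]; first by rewrite mulr_le0_ge0 // exprn_ge0.
exact: (mxOverP dR).
Qed.

Lemma hermitian_inertia n p q (A : 'M[C]_n) (B : 'M[C]_(p, n))
    (B' : 'M[C]_(q, n)) :
  A \is hermsymmx -> (p + q)%N = n ->
  (forall u : 'rV[C]_p, u != 0 -> 0 < herm_form A (u *m B)) ->
  (forall u : 'rV[C]_q, u != 0 -> herm_form A (u *m B') < 0) ->
  #|[set i | (0 < spectral_diag A 0 i)%R]| = p /\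
  #|[set i | (spectral_diag A 0 i < 0)%R]| = q.
Proof.
move=> hA npq posB negB.
have dR := hermitian_spectral_diag_real hA.
have /orthomx_spectralP := hermitian_normalmx hA.
have U := spectral_unitarymx A; rewrite invmx_unitary //.
set d := spectral_diag A in dR *; set P := spectralmx A => defA.
have lep : (p <= #|[set i | (0 < d 0 i)%R]|)%N.
  apply: (posdef_leq_card (U := P) (B := B)) => // u u0.
  by rewrite -defA; apply: posB.
have leq : (q <= #|[set i | (d 0 i < 0)%R]|)%N.
  (* The bound for negative entries is the one for positive entries applied to [- d], that is, to
     the form of [- A]. *)
  have -> : [set i | d 0 i < 0] = [set i | 0 < (- d) 0 i].
    by apply/setP => i; rewrite !inE mxE oppr_gt0.
  apply: (posdef_leq_card (U := P) (B := B')) => [|u u0].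
    by apply/mxOverP => i j; rewrite mxE rpredN; apply: (mxOverP dR).
  rewrite linearN /= mulmxN mulNmx -defA /herm_form mulmxN mulNmx mxE oppr_gt0.
  exact: negB.
(* The two index sets are disjoint, which leaves no slack in either lower bound. *)
have leqn : (#|[set i | (0 < d 0 i)%R]| + #|[set i | (d 0 i < 0)%R]| <= p + q)%N.
  rewrite -cardsUI (_ : _ :&: _ = set0); last first.
    apply/setP => i; rewrite !inE; apply/negP => /andP[d0 /(lt_trans d0)].
    by rewrite ltxx.
  by rewrite cards0 addn0 npq -[X in (_ <= X)%N]card_ord max_card.
split; apply/eqP; rewrite eqn_leq ?lep ?leq andbT.
  by rewrite -(leq_add2r q); apply: leq_trans leqn; rewrite leq_add2l.
by rewrite -(leq_add2l p); apply: leq_trans leqn; rewrite leq_add2r.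
Qed.

Lemma saddle_inertia k M (G : 'M[C]_k) (W : 'M[C]_(M, k)) :
  G \is hermsymmx -> (forall u, u != 0 -> 0 < herm_form G u) -> \rank W = M ->
  let K := block_mx G (W^t*) W 0 in
  [/\ K \is hermsymmx, #|[set i | (0 < spectral_diag K 0 i)%R]| = k
    & #|[set i | (spectral_diag K 0 i < 0)%R]| = M].
Proof.
move=> hG posG rW K.
have Gt : G^t* = G.
  by have := is_hermitianmxP _ _ _ hG; rewrite expr0 scale1r => <-.
have hK : K \is hermsymmx.
  apply/is_hermitianmxP; rewrite expr0 scale1r tr_block_mx map_block_mx Gt.
  by rewrite trmxCK trmx0 map_mx0.
have uG : G \in unitmx.
  rewrite -row_free_unit; apply: inj_row_free => u uG0.
  apply/eqP/negPn/negP => /posG.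
  by rewrite /herm_form uG0 mul0mx mxE ltxx.
pose B := row_mx 1%:M 0 : 'M[C]_(k, k + M).
(* The left block makes [B'] times the first block column of [K] vanish. What remains of the form is
   that of the Schur complement [- W *m invmx G *m W^t*], namely minus the form of [G] at [z]
   below. *)
pose B' := row_mx (- (W *m invmx G)) 1%:M : 'M[C]_(M, k + M).
have [||-> ->] // := hermitian_inertia (B := B) (B' := B') hK erefl.
  move=> u u0; rewrite /herm_form /B mul_mx_row mulmx1 mulmx0.
  rewrite tr_row_mx trmx0 map_col_mx map_mx0 mul_row_block mul_row_col.
  by rewrite !mul0mx mulmx0 !addr0; apply: posG.
move=> u u0; pose z := u *m (W *m invmx G).
have z0 : z != 0.
  rewrite /z mulmxA mulmx_free_eq0 ?row_free_unit ?unitmx_inv //.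
  by rewrite mulmx_free_eq0 // /row_free rW eqxx.
suff -> : herm_form K (u *m B') = - herm_form G z by rewrite oppr_lt0 posG.
have zG : z *m G = u *m W by rewrite /z mulmxA mulmxKV.
have Wz : W^t* = G *m (W *m invmx G)^t*.
  by rewrite -{1}Gt -map_mxM -trmx_mul mulmxKV.
have zt : z^t* = (W *m invmx G)^t* *m u^t* by rewrite /z trmx_mul map_mxM.
rewrite /herm_form /B' mul_mx_row mulmx1 mulmxN -/z mul_row_block tr_row_mx.
rewrite map_col_mx mul_row_col mulNmx zG addNr mul0mx add0r mulmx0 addr0 mulNmx.
by rewrite Wz mulNmx mxE -zG zt !mulmxA.
Qed.

End Hermitian.

(** Diagonalization takes place over the complex numbers, where conjugation fixes the entries of
    real matrices. The eigenvalues obtained are real, so taking real parts loses nothing. *)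
Lemma kkt_spectrum (R : realType) (N M k : nat)
    (V : 'M[R]_(N, k)) (W : 'M[R]_(M, k)) :
  \rank V = k -> \rank W = M ->
  exists s : seq R, [/\ spectrum (kkt_mx V W) s,
    count (fun z => 0 < z) s = k & count (fun z => z < 0) s = M].
Proof.
move=> rV rW; pose f := real_complex R.
have ct m n (A : 'M[R]_(m, n)) : (map_mx f A)^t* = map_mx f A^T.
  by apply/matrixP => i j; rewrite !mxE; apply: conjc_real.
pose Vc := map_mx f V; pose Wc := map_mx f W.
have hG : Vc^t* *m Vc \is hermsymmx.
  by apply/is_hermitianmxP; rewrite expr0 scale1r trmx_mul map_mxM trmxCK.
have posG u : u != 0 -> 0 < herm_form (Vc^t* *m Vc) u.
  by apply: herm_form_gram; rewrite mxrank_map.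
have [|/=] := saddle_inertia (W := Wc) hG posG; first by rewrite mxrank_map.
have -> : block_mx (Vc^t* *m Vc) (Wc^t*) Wc 0 = map_mx f (kkt_mx V W).
  by rewrite !ct -map_mxM /kkt_mx map_block_mx map_mx0.
set K := map_mx f _ => hK cpos cneg.
have dR := hermitian_spectral_diag_real hK.
set d := spectral_diag K in dR cpos cneg *.
pose e (i : 'I_(k + M)) : R := complex.Re (d 0 i).
have eE i : f (e i) = d 0 i by apply: RRe_real; apply: (mxOverP dR).
exists [seq e i | i : 'I_(k + M)]; split; last 2 first.
- rewrite count_map enumT -[RHS]cpos cardE size_filter; apply: eq_count => i /=.
  by rewrite !inE -eE -(rmorph0 f) ltcR.
- rewrite count_map enumT -[RHS]cneg cardE size_filter; apply: eq_count => i /=.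
  by rewrite !inE -eE -(rmorph0 f) ltcR.
(* The factorization is checked over the complex numbers, where the matrix is similar to a diagonal
   one. *)
apply: (map_poly_inj f).
rewrite map_char_poly -/K.
have /orthomx_spectralP -> := hermitian_normalmx hK.
rewrite char_poly_invmx_conj ?spectral_unit // char_poly_trig ?diag_mx_is_trig //.
rewrite big_map big_enum rmorph_prod; apply: eq_bigr => i _ /=.
by rewrite rmorphB /= map_polyX map_polyC mxE eqxx mulr1n -/d -eE.
Qed.

Theorem theorem1 (R : realType) (m r n : nat) (ltmr : (m < r)%N) (ltrn : (r < n)%N)
    (x : 'I_((n + 1) ^ 2) -> sphere R) (x_inj : injective x)
    (x' : 'I_((m + 1) ^ 2) -> sphere R) (x'_inj : injective x')
    (x'_sub : forall i, exists k, x' i = x k)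
    (b : 'I_((r + 1) ^ 2) -> sphere R -> R) (b_basis : spherical_basis r b)
    (rankN : \rank (vandermonde_mx x b) = ((r + 1) ^ 2)%N)
    (rankM : \rank (vandermonde_mx x' b) = ((m + 1) ^ 2)%N) :
  let K := kkt_mx (vandermonde_mx x b) (vandermonde_mx x' b) in
  K \in unitmx /\
  exists s : seq R,
    [/\ spectrum K s,
        count (fun z => 0 < z) s = ((r + 1) ^ 2)%N
      & count (fun z => z < 0) s = ((m + 1) ^ 2)%N].
Proof.
move=> K; have [s [sK pos neg]] := kkt_spectrum rankN rankM.
split; last by exists s.
by apply: (spectrum_unitmx sK); rewrite pos neg.
Qed.
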